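(* Let $\mathcal{G}$ be a Hausdorff ultrabornological $\widetilde{\mathbb{C}}$-module and let $\mathcal{F}$ be a locally convex topological $\widetilde{\mathbb{C}}$-module which has a web of type $\mathcal{C}$. If a $\widetilde{\mathbb{C}}$-linear map $T:\mathcal{G}\to\mathcal{F}$ has sequentially closed graph (in $\mathcal{G}\times\mathcal{F}$ with the product topology), then $T$ is continuous.
   Context: Generalized numbers: $\widetilde{\mathbb{C}}=\mathcal{E}_M/\mathcal{N}$, where $\mathcal{E}_M$ is the ring of nets $(c_\varepsilon)_\varepsilon\in\mathbb{C}^{(0,1]}$ with $|c_\varepsilon|=O(\varepsilon^{-N})$ as $\varepsilon\to0$ for some $N\in\mathbb{N}$, and $\mathcal{N}$ is the ideal of nets with $|c_\varepsilon|=O(\varepsilon^{q})$ for all $q\in\mathbb{N}$; $[(c_\varepsilon)_\varepsilon]$ denotes the class of $(c_\varepsilon)_\varepsilon$. The valuation is $\mathrm{v}(c)=\sup\{b\in\mathbb{R}: |c_\varepsilon|=O(\varepsilon^b)\text{ as }\varepsilon\to0\}$ and $|c|_{\mathrm e}=e^{-\mathrm{v}(c)}$; $\widetilde{\mathbb{C}}$ carries the topology of the ultrametric $|c-d|_{\mathrm e}$. A topological $\widetilde{\mathbb{C}}$-module is a $\widetilde{\mathbb{C}}$-module with a topology making addition and scalar multiplication $\widetilde{\mathbb{C}}\times\mathcal{G}\to\mathcal{G}$ continuous. A subset $A$ of a $\widetilde{\mathbb{C}}$-module is balanced if $\lambda A\subseteq A$ whenever $|\lambda|_{\mathrm e}\le1$;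 convex if $A+A\subseteq A$ and $[(\varepsilon^b)_\varepsilon]A\subseteq A$ for all $b\ge0$; absolutely convex if balanced and convex. A topological $\widetilde{\mathbb{C}}$-module is locally convex if it has a base of convex neighborhoods of $0$. A set $A$ absorbs a set $B$ if there is $a\in\mathbb{R}$ with $B\subseteq[(\varepsilon^b)_\varepsilon]A$ for all $b\le a$; a set is bounded if it is absorbed by every neighborhood of $0$. A disk is a nonempty, balanced and convex set $A\subseteq\mathcal{G}$. For a disk $A$ let $\mathcal{G}_A=\bigcup_{n\in\mathbb{N}}[(\varepsilon^{-n})_\varepsilon]A$ (the submodule generated by $A$), and for $u\in\mathcal{G}_A$ let $\mathrm{v}_A(u)=\sup\{b\in\mathbb{R}:u\in[(\varepsilon^b)_\varepsilon]A\}$ and $\mathcal{P}_A(u)=e^{-\mathrm{v}_A(u)}$. $A$ is a Banach disk if $(\mathcal{G}_A,\mathcal{P}_A)$ is a Banach $\widetilde{\mathbb{C}}$-module, i.e. $\mathcal{P}_A(u)=0$ only for $u=0$ and $\mathcal{G}_A$ is complete for the metric $\mathcal{P}_A(u-v)$. A subset of a locally convex topological $\widetilde{\mathbb{C}}$-module $\mathcal{G}$ is ultrabornivorous if it absorbs every bounded Banach disk of $\mathcal{G}$; $\mathcal{G}$ is ultrabornological if it is a locally convex topological $\widetilde{\mathbb{C}}$-module in which every absolutely convex ultrabornivorous subset is a neighborhood of $0$. A web on a locally convex topological $\widetilde{\mathbb{C}}$-module $\mathcal{F}$ is a family $\mathcal{W}=\{C(n_1,\dots,n_k)\}$ of subsets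 of $\mathcal{F}$, with $k,n_1,\dots,n_k$ running through $\mathbb{N}\setminus0$, such that $\mathcal{F}=\bigcup_{n_1\ge1}C(n_1)$ and $C(n_1,\dots,n_{k-1})=\bigcup_{n_k\ge1}C(n_1,\dots,n_k)$ for all $k>1$ and all $n_1,\dots,n_{k-1}$. It is of type $\mathcal{C}$ if for every sequence $(n_k)_{k\ge1}$ in $\mathbb{N}\setminus0$ there is a sequence $(\rho_k)_{k\ge1}$ in $\mathbb{R}$ such that for all $\lambda_k\ge\rho_k$ and all $x_k\in C(n_1,\dots,n_k)$ ($k\ge1$) the series $\sum_{k=1}^\infty[(\varepsilon^{\lambda_k})_\varepsilon]x_k$ converges in $\mathcal{F}$. *)

(* Defs.v *)
From HB Require Import structures.
From mathcomp Require Import all_boot all_order all_algebra.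
From mathcomp Require Import generic_quotient ring_quotient.
From mathcomp Require Import complex.
From mathcomp Require Import all_classical all_reals all_analysis.

Set Implicit Arguments.
Unset Strict Implicit.
Unset Printing Implicit Defensive.

Import Order.TTheory GRing.Theory Num.Theory.
Import numFieldNormedType.Exports.
Import ComplexField.Normc.

Local Open Scope classical_set_scope.
Local Open Scope ring_scope.

Definition eps_index (R : realType) := {e : R | 0 < e <= 1}.

Section Nets.
Variable R : realType.

HB.instance Definition _ := Choice.on (eps_index R).

Let one_index : 0 < (1 : R) <= 1. Proof. by rewrite ltr01 lexx. Qed.

HB.instance Definition _ :=
  isPointed.Build (eps_index R) (exist _ 1 one_index).

Definition eps_to_0 : set_system (eps_index R) :=
  filter_from [set d : R | 0 < d] (fun d => [set e | val e < d]).

#[global] Instance eps_to_0_filter : ProperFilter eps_to_0.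
Proof.
apply: filter_from_proper; last first.
  move=> d /= d0.
  have m0 : 0 < Num.min (d / 2) 1 <= 1.
    by rewrite lt_min divr_gt0// ltr01 ge_min lexx orbT.
  exists (exist (fun e : R => 0 < e <= 1) _ m0) => /=.
  by rewrite gt_min; apply/orP; left; rewrite ltr_pdivrMr// ltr_pMr// ltr1n.
apply: filter_from_filter; first by exists 1 => /=.
move=> i j /= i0 j0; exists (Num.min i j); first by rewrite /= lt_min i0.
by move=> e /=; rewrite lt_min => /andP[].
Qed.

Canonical eps_to_0_filter_on := FilterType eps_to_0 eps_to_0_filter.

Definition net := eps_index R -> R[i].

HB.instance Definition _ := GRing.ComNzRing.on net.

Definition growth (c : net) (b : R) : Prop :=
  (fun e => normc (c e) : R^o) =O_eps_to_0 (fun e => val e `^ b : R^o).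

Lemma normc_ge0 (z : R[i]) : 0 <= normc z.
Proof. by case: z => a b /=; rewrite sqrtr_ge0. Qed.

Lemma normcD (x y : R[i]) : normc (x + y) <= normc x + normc y.
Proof. by rewrite -lecR rmorphD /=; exact: ComplexField.lec_normD. Qed.

Lemma normcN (x : R[i]) : normc (- x) = normc x.
Proof. by case: x => a b /=; rewrite !sqrrN. Qed.

Lemma growthP (c : net) (b : R) : growth c b <->
  exists2 k, 0 < k & \forall e \near eps_to_0, normc (c e) <= k * val e `^ b.
Proof.
rewrite /growth eqO_exP.
have nn z : `|(normc z : R^o)| = normc z by rewrite ger0_norm // normc_ge0.
split=> -[k k0 H]; exists k => //; apply: filterS H => e /=;
  by rewrite nn (@ger0_norm _ (_ `^ _)) ?powR_ge0.
Qed.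

Lemma growth_le (c : net) (a b : R) : a <= b -> growth c b -> growth c a.
Proof.
move=> ab /growthP[k k0 H]; apply/growthP; exists k => //.
apply: filterS H => e /le_trans; apply.
by rewrite ler_wpM2l ?(ltW k0)// ger_powR// (valP e).
Qed.

Lemma growthD (c d : net) (b : R) :
  growth c b -> growth d b -> growth (c + d) b.
Proof.
move=> /growthP[k k0 H] /growthP[l l0 K]; apply/growthP.
exists (k + l); first exact: addr_gt0.
apply: filterS2 H K => e ce de.
by rewrite mulrDl (le_trans (normcD _ _))// lerD.
Qed.

Lemma growthN (c : net) (b : R) : growth c b -> growth (- c) b.
Proof.
move=> /growthP[k k0 H]; apply/growthP; exists k => //.
by apply: filterS H => e; rewrite -normcN.
Qed.

Lemma growthM (c d : net) (a b : R) :
  growth c a -> growth d b -> growth (c * d) (a + b).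
Proof.
move=> /growthP[k k0 H] /growthP[l l0 K]; apply/growthP.
exists (k * l); first exact: mulr_gt0.
apply: filterS2 H K => e ce de.
have /andP[e0 _] := valP e.
rewrite powRD; last by rewrite (gt_eqF e0) implybT.
by rewrite normcM mulrACA ler_pM ?normc_ge0.
Qed.

Lemma growth0 (b : R) : growth 0 b.
Proof.
apply/growthP; exists 1 => //; apply: nearW => e.
by rewrite normc0 mul1r powR_ge0.
Qed.

Definition power_net (b : R) : net := fun e => (val e `^ b)%:C%C.

Lemma growth_power (b : R) : growth (power_net b) b.
Proof.
apply/growthP; exists 1 => //; apply: nearW => e.
by rewrite mul1r /= expr0n addr0 sqrtr_sqr ger0_norm ?powR_ge0.
Qed.

Lemma growth1 : growth 1 0.
Proof.
apply/growthP; exists 1 => //; apply: nearW => e.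
by rewrite powRr0 normc1 mulr1.
Qed.

Definition moderate : {pred net} :=
  fun c => `[< exists N : nat, growth c (- N%:R) >].

Lemma growth_moderate (c : net) (b : R) : growth c b -> c \in moderate.
Proof.
move=> cb; apply/asboolP; exists (Num.truncn `|b|).+1.
apply: growth_le cb; rewrite lerNl.
by rewrite (le_trans (ler_norm _))// normrN ltW// truncnS_gt.
Qed.

Lemma moderate_subring : subring_closed moderate.
Proof.
split.
- exact: growth_moderate growth1.
- move=> c d /asboolP[N cN] /asboolP[M dM].
  apply: (@growth_moderate _ (- (N + M)%:R)).
  apply: growthD; last apply: growthN.
    by apply: growth_le cN; rewrite lerN2 ler_nat leq_addr.
  by apply: growth_le dM; rewrite lerN2 ler_nat leq_addl.
- move=> c d /asboolP[N cN] /asboolP[M dM].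
  exact: growth_moderate (growthM cN dM).
Qed.

HB.instance Definition _ :=
  GRing.isSubringClosed.Build net moderate moderate_subring.

Record moderate_net := ModerateNet {
  net_of :> net ;
  net_ofP : net_of \in moderate }.

HB.instance Definition _ := [isSub for net_of].
HB.instance Definition _ := [Choice of moderate_net by <:].
HB.instance Definition _ :=
  [SubChoice_isSubComNzRing of moderate_net by <:].

Definition negligible_net : {pred moderate_net} :=
  fun c => `[< forall q : nat, growth c q%:R >].

Lemma negligible_idealr : idealr_closed negligible_net.
Proof.
split.
- by apply/asboolP => q; exact: growth0.
- apply/negP => /asboolP /(_ 1%N) /growthP[k k0 [d /= d0 H]].
  pose m := Num.min (Num.min (d / 2) 1) (k^-1 / 2).
  have m0 : 0 < m <= 1.
    rewrite !lt_min !divr_gt0 ?invr_gt0// ltr01 /=.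
    by rewrite !ge_min lexx orbT.
  have := H (exist (fun e : R => 0 < e <= 1) m m0); rewrite /= !powRr1; last by case/andP: m0 => /ltW.
  have md : m < d.
    rewrite gt_min gt_min; apply/orP; left; apply/orP; left.
    by rewrite ltr_pdivrMr// ltr_pMr// ltr1n.
  move=> /(_ md); rewrite expr1n expr0n addr0 sqrtr1 leNgt => /negP; apply.
  rewrite -ltr_pdivlMl// mulr1 gt_min; apply/orP; right.
  by rewrite ltr_pdivrMr// ltr_pMr ?invr_gt0// ltr1n.
- move=> a u v /asboolP uN /asboolP vN; apply/asboolP => q.
  have /asboolP[N aN] := net_ofP a.
  apply: (@growthD (net_of a * net_of u)) (vN q).
  by have := growthM aN (uN (N + q)%N); rewrite natrD addKr.
Qed.

HB.instance Definition _ :=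
  isIdealr.Build moderate_net negligible_net negligible_idealr.

End Nets.

Definition gcomplex (R : realType) := {ideal_quot (@negligible_net R)}.

HB.instance Definition _ (R : realType) := GRing.ComNzRing.on (gcomplex R).

Section GeneralizedNumbers.
Variable R : realType.
Implicit Types u v w : gcomplex R.

Local Open Scope quotient_scope.

Definition gclass (c : moderate_net R) : gcomplex R :=
  \pi_({ideal_quot (@negligible_net R)}) c.

Definition epow (b : R) : gcomplex R :=
  gclass (ModerateNet (growth_moderate (growth_power b))).

(* The representative chosen by [repr] is irrelevant: see [valuation_class]. *)
Definition valuation u : \bar R :=
  ereal_sup [set b%:E | b in [set b : R | growth (repr u : moderate_net R) b]].

Definition abs_e u : R := fine (expeR (- valuation u)).

Lemma negligible_growth (c : moderate_net R) (b : R) :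
  c \in @negligible_net R -> growth c b.
Proof.
move=> /asboolP cN; apply: growth_le (cN (Num.truncn `|b|).+1).
by rewrite (le_trans (ler_norm _))// ltW// truncnS_gt.
Qed.

Lemma growth_eq_mod (c d : moderate_net R) (b : R) :
  c - d \in @negligible_net R -> growth d b -> growth c b.
Proof.
move=> cd db; rewrite -[c](subrK d).
exact: (@growthD _ (net_of (c - d)) (net_of d)) (negligible_growth b cd) db.
Qed.

Lemma growth_repr (c : moderate_net R) (b : R) :
  growth (repr (gclass c) : moderate_net R) b <-> growth c b.
Proof.
have H : repr (gclass c) - c \in @negligible_net R.
  by rewrite Quotient.idealrBE reprK.
split; last exact: growth_eq_mod.
by apply: growth_eq_mod; rewrite -opprB rpredN.
Qed.

Lemma valuation_class (c : moderate_net R) :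
  valuation (gclass c) =
  ereal_sup [set b%:E | b in [set b : R | growth c b]].
Proof.
rewrite /valuation; congr (ereal_sup (_ @` _)).
by apply/seteqP; split => b /growth_repr.
Qed.

Lemma gclass_repr u : gclass (repr u) = u.
Proof. exact: reprK. Qed.

Lemma gclassB (c d : moderate_net R) : gclass (c - d) = gclass c - gclass d.
Proof. by rewrite /gclass raddfB. Qed.

Lemma gclassD (c d : moderate_net R) : gclass (c + d) = gclass c + gclass d.
Proof. by rewrite /gclass raddfD. Qed.

Lemma valuation_gtNy u : (-oo < valuation u)%E.
Proof.
have /asboolP[N uN] := net_ofP (repr u).
apply: (@lt_le_trans _ _ (- N%:R)%:E); first by rewrite ltNyr.
by apply: ereal_sup_ubound; exists (- N%:R).
Qed.

Lemma abs_eE u : (abs_e u)%:E = expeR (- valuation u).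
Proof.
rewrite /abs_e fineK// fin_numE expeR_eqy.
have := expeR_ge0 (- valuation u).
have := valuation_gtNy u.
by case: (valuation u) => [r| |].
Qed.

Lemma valuationN u : valuation (- u) = valuation u.
Proof.
suff le w : (valuation w <= valuation (- w)%R)%E.
  by apply/eqP; rewrite eq_le le andbT -{2}[u]opprK le.
rewrite -[w]gclass_repr -sub0r -[0]gclass_repr -gclassB !valuation_class.
apply: ereal_sup_le => _ [b wb <-]; exists b => //=.
have z0 : growth (repr (0 : gcomplex R) : moderate_net R) b.
  apply: negligible_growth; rewrite -[repr _]subr0 Quotient.idealrBE reprK.
  by rewrite raddf0.
exact: growthD z0 (growthN wb).
Qed.

Lemma valuationD u v :
  (Order.min (valuation u) (valuation v) <= valuation (u + v)%R)%E.
Proof.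
rewrite leNgt; apply/negP; rewrite lt_min => /andP[].
move=> /ereal_sup_gt[_ [b ub <-]] uvb /ereal_sup_gt[_ [c vc <-]] uvc.
have : ((Num.min b c)%:E <= valuation (u + v)%R)%E.
  rewrite -[u]gclass_repr -[v]gclass_repr -gclassD valuation_class.
  apply: ereal_sup_ubound; exists (Num.min b c) => //=.
  apply: (@growthD _ (net_of (repr u)) (net_of (repr v))).
    by apply: growth_le ub; rewrite ge_min lexx.
  by apply: growth_le vc; rewrite ge_min lexx orbT.
by rewrite leNgt EFin_min lt_min uvb uvc.
Qed.

Lemma valuation_eqy u : valuation u = +oo%E -> u = 0.
Proof.
move=> uy; rewrite -[u]gclass_repr; apply/eqP.
rewrite -[0](raddf0 (\pi_({ideal_quot (@negligible_net R)}))).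
rewrite /gclass -Quotient.idealrBE subr0; apply/asboolP => q.
have : (q%:R%:E < valuation u)%E by rewrite uy ltry.
move=> /ereal_sup_gt[_ [b ub <-]]; rewrite lte_fin => /ltW qb.
exact: growth_le ub.
Qed.

Lemma valuation0 : valuation 0 = +oo%E.
Proof.
have -> : 0 = gclass 0 by rewrite /gclass raddf0.
rewrite valuation_class.
set v := ereal_sup _.
have vge b : (b%:E <= v)%E.
  by apply: ereal_sup_ubound; exists b => //; exact: growth0.
case: v vge => [r| |] // vge; last by have := vge 0.
by have := vge (r + 1); rewrite lee_fin gerDl ler10.
Qed.

Lemma abs_e0 : abs_e 0 = 0.
Proof. by rewrite /abs_e valuation0. Qed.

Lemma abs_eN u : abs_e (- u) = abs_e u.
Proof. by rewrite /abs_e valuationN. Qed.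

Lemma abs_e_eq0 u : abs_e u = 0 -> u = 0.
Proof.
move=> u0; apply: valuation_eqy; have := abs_eE u; rewrite u0.
move=> /esym/eqP; rewrite expeR_eq0 => /eqP uNy.
by rewrite -[valuation u]oppeK uNy.
Qed.

Lemma abs_e_ge0 u : 0 <= abs_e u.
Proof. by rewrite -lee_fin abs_eE expeR_ge0. Qed.

Lemma abs_e_max u v : abs_e (u + v) <= Num.max (abs_e u) (abs_e v).
Proof.
rewrite le_max -!lee_fin !abs_eE !lee_expeR !leeN2.
by have := valuationD u v; rewrite ge_min.
Qed.

Lemma abs_e_triangle v u w : abs_e (u - w) <= abs_e (u - v) + abs_e (v - w).
Proof.
rewrite -[u - w](subrKA v) (le_trans (abs_e_max _ _))//.
by rewrite ge_max lerDl lerDr !abs_e_ge0.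
Qed.

Let gdist u v : R := abs_e (u - v).

Let gdistxx u : gdist u u = 0.
Proof. by rewrite /gdist subrr abs_e0. Qed.

Let gdist_positivity u v : gdist u v = 0 -> u = v.
Proof. by move=> /abs_e_eq0/eqP; rewrite subr_eq0 => /eqP. Qed.

Let gdist_sym u v : gdist u v = gdist v u.
Proof. by rewrite /gdist -opprB abs_eN. Qed.

HB.instance Definition _ := isMetric.Build R (gcomplex R)
  gdistxx gdist_positivity gdist_sym abs_e_triangle.

End GeneralizedNumbers.

(* The topological modules of MathComp-Analysis have a [numDomainType] of
   scalars, and its join of topological spaces with [lmodType] prevents another
   such join with different scalars.  The scaling operation is therefore part of
   the mixin, and [lmodType (gcomplex R)] is recovered as an instance. *)
HB.mixin Record isTopologicalGModule (R : realType) M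
    & Topological M & GRing.Zmodule M := {
  gscale : gcomplex R -> M -> M ;
  gscaleA : forall a b x, gscale a (gscale b x) = gscale (a * b) x ;
  gscale1 : left_id 1 gscale ;
  gscaleDr : right_distributive gscale +%R ;
  gscaleDl : forall x, {morph gscale^~ x : a b / a + b} ;
  gscale_continuous : continuous (fun z : gcomplex R * M => gscale z.1 z.2)
}.

(* [TopologicalZmodule] provides the continuity of the addition, and that of the
   opposite, which follows anyway from that of the scaling by -1. *)
#[short(type="topologicalGModType")]
HB.structure Definition TopologicalGModule (R : realType) :=
  {M of TopologicalZmodule M & isTopologicalGModule R M}.

HB.instance Definition _ (R : realType) (M : topologicalGModType R) :=
  GRing.Zmodule_isLmodule.Build (gcomplex R) M
    (@gscaleA R M) (@gscale1 R M) (@gscaleDr R M) (@gscaleDl R M).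

Lemma scaler_continuous (R : realType) (M : topologicalGModType R) :
  continuous (fun z : gcomplex R * M => z.1 *: z.2).
Proof. exact: gscale_continuous. Qed.

Section Modules.
Variables (R : realType) (G : topologicalGModType R).
Implicit Types A B : set G.

Definition escale (b : R) A : set G := [set epow b *: x | x in A].

Definition gbalanced A : Prop :=
  forall l : gcomplex R, abs_e l <= 1 -> [set l *: x | x in A] `<=` A.

Definition gconvex A : Prop :=
  [set x + y | x in A & y in A] `<=` A /\
  forall b : R, 0 <= b -> escale b A `<=` A.

Definition gabsolutely_convex A : Prop := gbalanced A /\ gconvex A.

Definition glocally_convex : Prop :=
  forall U : set G, nbhs 0 U -> exists V : set G,
    [/\ nbhs 0 V, gconvex V & V `<=` U].

Definition absorbs A B : Prop :=
  exists a : R, forall b : R, b <= a -> B `<=` escale b A.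

Definition gbounded B : Prop := forall U : set G, nbhs 0 U -> absorbs U B.

Definition disk A : Prop := [/\ A !=set0, gbalanced A & gconvex A].

Definition disk_span A : set G := \bigcup_n escale (- n%:R) A.

Definition disk_valuation A (u : G) : \bar R :=
  ereal_sup [set b%:E | b in [set b : R | escale b A u]].

(* Finite on [disk_span A]. *)
Definition disk_norm A (u : G) : \bar R := expeR (- disk_valuation A u).

Definition disk_complete A : Prop :=
  forall u : nat -> G, (forall n, disk_span A (u n)) ->
    (forall e : R, 0 < e -> exists N : nat, forall m n : nat,
       (N <= m)%N -> (N <= n)%N -> (disk_norm A (u m - u n)%R < e%:E)%E) ->
  exists2 l : G, disk_span A l &
    forall e : R, 0 < e -> exists N : nat, forall n : nat,
      (N <= n)%N -> (disk_norm A (u n - l)%R < e%:E)%E.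

Definition Banach_disk A : Prop :=
  [/\ disk A,
      forall u, disk_span A u -> disk_norm A u = 0%E -> u = 0 &
      disk_complete A].

Definition ultrabornivorous A : Prop :=
  forall B, Banach_disk B -> gbounded B -> absorbs A B.

Definition ultrabornological : Prop :=
  glocally_convex /\
  forall A, gabsolutely_convex A -> ultrabornivorous A -> nbhs 0 A.

(* [C [:: n_1; ...; n_k]] stands for C(n_1, ..., n_k); its values at the empty
   sequence and at sequences containing 0 are irrelevant. *)
Definition is_web (C : seq nat -> set G) : Prop :=
  [set: G] = \bigcup_(n in [set n | (0 < n)%N]) C [:: n] /\
  forall s : seq nat, s != [::] -> all (ltn 0) s ->
    C s = \bigcup_(n in [set n | (0 < n)%N]) C (rcons s n).

Definition web_type_C (C : seq nat -> set G) : Prop :=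
  forall n : nat -> nat, (forall k, (0 < k)%N -> (0 < n k)%N) ->
  exists rho : nat -> R, forall (lambda : nat -> R) (x : nat -> G),
    (forall k, (0 < k)%N ->
       rho k <= lambda k /\ C [seq n i | i <- iota 1 k] (x k)) ->
  exists l : G,
    (fun m => \sum_(1 <= k < m.+1) epow (lambda k) *: x k) @ \oo --> l.

Definition has_web_type_C : Prop :=
  exists2 C : seq nat -> set G, is_web C & web_type_C C.

End Modules.

Arguments glocally_convex {R} G.
Arguments ultrabornological {R} G.
Arguments has_web_type_C {R} G.

Definition sequentially_closed (X : topologicalType) (A : set X) : Prop :=
  forall u : nat -> X, (forall n, A (u n)) ->
  forall l : X, u @ \oo --> l -> A l.

Definition graph (X Y : Type) (f : X -> Y) : set (X * Y) :=
  [set z | z.2 = f z.1].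

(* Main.v *)
Require Import Defs.
From mathcomp Require Import all_boot all_order all_algebra.
From mathcomp Require Import all_classical all_reals all_analysis.
From mathcomp Require Import complex lra.

Set Implicit Arguments.
Unset Strict Implicit.
Unset Printing Implicit Defensive.

Import Order.TTheory GRing.Theory Num.Theory.

Local Open Scope classical_set_scope.
Local Open Scope ring_scope.

(** The proof is De Wilde's gliding argument.

    Continuity of T at 0 means that the preimage of every neighborhood V of 0
    in F is a neighborhood of 0 in G.  As F is locally convex, V may be taken
    absolutely convex ([locally_gabsconvex]); its preimage is then absolutely
    convex, and since G is ultrabornological it remains to see that this
    preimage absorbs each bounded Banach disk B.  Equivalently, it contains
    [escale n B] for some n ([closed_graph_Banach_disk]).

    The sets [escale n B] form a decreasing sequence of subgroups, which is a
    base of neighborhoods of 0 for a complete metrizable topology on the span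
    of B ([Banach_disk_filtration]), so that Baire's theorem is available there
    ([Baire_nonmeagre]).  A nonmeagre set that is the union of a sequence has a
    nonmeagre member; going down the web, this yields a branch n_1, n_2, ...
    along which all the preimages of C(n_1, ..., n_k) are nonmeagre
    ([web_nonmeagre_branch]).  For each k, the preimage of a large multiple of V
    further cuts this set to a nonmeagre D_k ([nonmeagre_bounded_part]), whose
    closure contains a ball around one of its points x_k
    ([nonmeagre_somewhere_dense]).  For lambda_k large, T sends
    epsilon^lambda_k D_k into V.

    A point x0 close enough to 0 in the span of B is now the sum of a series
    with terms epsilon^lambda_k (d_k - x_k), where d_k is in D_k: the
    density of D_k near x_k allows to choose d_k so that the remainder, which
    was small at scale k, becomes small at scale k + 1.  Boundedness of B
    makes the series converge to x0 in G.  The web being of type C,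
    the images of the partial sums converge in F, and as the graph is
    sequentially closed their limit is T x0.  All these images lie in
    V, which is a subgroup and a neighborhood of 0, hence closed: so T x0 is
    in V. *)

(** * Powers of epsilon and the norm of generalized numbers *)

Section Powers.
Variable R : realType.
Implicit Types a b : R.

Lemma epow0 : epow 0 = 1 :> gcomplex R.
Proof.
rewrite /epow -[RHS](rmorph1 (\pi_({ideal_quot (@negligible_net R)}))%qT).
congr (gclass _); apply: val_inj; apply/funext => e /=.
by rewrite /power_net powRr0.
Qed.

Lemma epowD a b : epow (a + b) = epow a * epow b.
Proof.
rewrite /epow /gclass.
rewrite -[RHS](rmorphM (\pi_({ideal_quot (@negligible_net R)}))%qT).
congr (gclass _); apply: val_inj; apply/funext => e /=.
have /andP[e0 _] := valP e.
rewrite /power_net powRD; last by rewrite (gt_eqF e0) implybT.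
exact: (rmorphM (real_complex R)).
Qed.

Lemma epowK a : epow (- a) * epow a = 1.
Proof. by rewrite -epowD addNr epow0. Qed.

Lemma abs_epow_le b : abs_e (epow b) <= expR (- b).
Proof.
rewrite -lee_fin abs_eE -[(expR _)%:E]/(expeR (- b)%:E) lee_expeR.
rewrite EFinN leeN2 valuation_class; apply: ereal_sup_ubound.
by exists b => //; exact: growth_power.
Qed.

Lemma abs_eN1_le : abs_e (-1 : gcomplex R) <= 1.
Proof. by rewrite abs_eN -epow0 (le_trans (abs_epow_le _))// oppr0 expR0. Qed.

Lemma abs_epow_lt (r : R) : 0 < r ->
  exists p : R, forall b, p <= b -> abs_e (epow b) < r.
Proof.
move=> r0; exists (1 - ln r) => b pb; apply: le_lt_trans (abs_epow_le b) _.
by rewrite -[r in ltRHS]lnK// ltr_expR; lra.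
Qed.

Lemma valuationM (u v : gcomplex R) :
  (valuation u + valuation v <= valuation (u * v)%R)%E.
Proof.
have growM b c : (b%:E < valuation u -> c%:E < valuation v ->
    (b + c)%:E <= valuation (u * v)%R)%E.
  move=> /ereal_sup_gt[_ [b' ub' <-]] /ltW bb'.
  move=> /ereal_sup_gt[_ [c' vc' <-]] /ltW cc'.
  rewrite -[u]gclass_repr -[v]gclass_repr /gclass.
  rewrite -(rmorphM (\pi_({ideal_quot (@negligible_net R)}))%qT).
  rewrite -/(gclass _) valuation_class.
  apply: (@le_trans _ _ (b' + c')%:E); first by rewrite lee_fin lerD.
  by apply: ereal_sup_ubound; exists (b' + c') => //; exact: growthM.
case: (valuation u) (valuation_gtNy u) growM (@valuation_eqy _ u) => [r||]//.
  case: (valuation v) (valuation_gtNy v) (@valuation_eqy _ v) => [s||]// _.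
  (* The exponent r is a supremum that [u] need not attain. *)
  - move=> _ _ growM _; apply/lee_subgt0Pr => e e0.
    have -> : (r%:E + s%:E - e%:E)%E = ((r - e / 2) + (s - e / 2))%:E.
      by rewrite -!EFinD; congr (_%:E); lra.
    by apply: growM; rewrite lte_fin; lra.
  - by move=> /(_ erefl) -> _ _ _; rewrite mulr0 valuation0 leey.
by move=> _ _ /(_ erefl) ->; rewrite mul0r valuation0 leey.
Qed.

Lemma abs_eM (u v : gcomplex R) : abs_e (u * v) <= abs_e u * abs_e v.
Proof.
rewrite -lee_fin EFinM !abs_eE -expeRD lee_expeR.
have := valuationM u v.
case: (valuation u) (valuation_gtNy u) => [r||]//;
  case: (valuation v) (valuation_gtNy v) => [s||]//;
  case: (valuation (u * v)) => [t||]//= _ _; rewrite ?leNye//.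
by rewrite -!EFinD !lee_fin; lra.
Qed.

Lemma abs_eM_le (u v : gcomplex R) (r : R) :
  abs_e u <= 1 -> abs_e v <= r -> abs_e (u * v) <= r.
Proof.
move=> u1 vr; rewrite (le_trans (abs_eM _ _))// (le_trans _ vr)//.
by rewrite ler_piMl// abs_e_ge0.
Qed.

End Powers.

(** * Baire's theorem for complete groups filtered by subgroups *)

Section Baire.
Variables (E : zmodType) (X : set E) (U : nat -> set E).

(** The translates of the [U n] are balls that make [X] a complete
    pseudo-ultrametric space.  Working with subsets of [E] avoids turning [X]
    into a type with its own topology. *)
Record complete_filtration : Prop := CompleteFiltration {
  span0 : X 0 ;
  spanD : forall n x u, X x -> U n u -> X (x + u) ;
  filt0 : forall n, U n 0 ;
  filtB : forall n u v, U n u -> U n v -> U n (u - v) ;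
  filt_le : forall m n, (m <= n)%N -> U n `<=` U m ;
  filt_complete : forall u : nat -> E, (forall n, X (u n)) ->
    (forall k, exists N, forall i j, (N <= i)%N -> (N <= j)%N ->
       U k (u i - u j)) ->
    exists2 l, X l & forall k, exists N, forall i, (N <= i)%N -> U k (u i - l)
}.

(** Every ball of [X] contains a ball that misses [S].  The set [S] may leave
    [X], which suits preimages under a map that is defined on all of [E]. *)
Definition nowhere_dense (S : set E) : Prop := forall x n, X x ->
  exists y m, U n (y - x) /\ forall z, U m (z - y) -> ~ S z.

Definition meagre (S : set E) : Prop := exists2 N : nat -> set E,
  forall i, nowhere_dense (N i) & S `<=` \bigcup_i N i.

Lemma meagre_sub (S S' : set E) : S `<=` S' -> meagre S' -> meagre S.
Proof. by move=> SS' [N Nnd S'N]; exists N => // x /SS' /S'N. Qed.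

Lemma meagre_bigcup (S : nat -> set E) :
  (forall i, meagre (S i)) -> meagre (\bigcup_i S i).
Proof.
move=> Smeagre.
have /choice[N NS] : forall i, exists N : nat -> set E,
    (forall j, nowhere_dense (N j)) /\ S i `<=` \bigcup_j N j.
  by move=> i; have [N] := Smeagre i; exists N.
pose N' k := if unpickle k is Some (i, j) then N i j else N 0%N k.
exists N'; first by rewrite /N' => k; case: (unpickle k) => [[i j]|];
  exact: (NS _).1.
move=> x [i _ /(NS i).2[j _ Nx]]; exists (pickle (i, j)) => //.
by rewrite /N' pickleK.
Qed.

Hypothesis filtration : complete_filtration.

Let filtN n u : U n u -> U n (- u).
Proof.
by move=> Uu; rewrite -sub0r; apply: (filtB filtration) => //; exact: filt0.
Qed.

Let filtD n u v : U n u -> U n v -> U n (u + v).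
Proof.
by move=> Uu /filtN Uv; rewrite -[v]opprK; exact: (filtB filtration).
Qed.

(** Baire's theorem: nested balls, the i-th of which avoids the i-th nowhere
    dense set, shrink to a point that is in none of these sets. *)
Lemma Baire_nonmeagre : ~ meagre X.
Proof.
move=> [N Nnd XN].
have /choice[f fP] : forall q : nat * (E * nat), exists q' : E * nat,
    X q.2.1 -> [/\ X q'.1, U q.2.2 (q'.1 - q.2.1), (q.2.2 < q'.2)%N
      & forall z, U q'.2 (z - q'.1) -> ~ N q.1 z].
  move=> [i [x n]] /=; have [Xx|nXx] := pselect (X x); last by exists (0, 0%N).
  have [y [m [yx my]]] := Nnd i x n Xx.
  exists (y, (maxn m n).+1) => _; split => //=.
  - by rewrite -(subrK x y) addrC; exact: spanD yx.
  - by rewrite ltnS leq_maxr.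
  - move=> z zy; apply: my; apply: filt_le zy => //.
    by rewrite leqW ?leq_maxl.
(* The i-th ball is the translate of [U (st i).2] by [(st i).1]. *)
pose st := fix st i := if i is j.+1 then f (j, st j) else (0, 0%N).
have stX i : X (st i).1.
  elim: i => [|i IH] /=; first exact: span0.
  by have [] := fP (i, st i) IH.
have stU i : U (st i).2 ((st i.+1).1 - (st i).1).
  by have [] := fP (i, st i) (stX i).
have stm i : ((st i).2 < (st i.+1).2)%N.
  by have [] := fP (i, st i) (stX i).
have stN i z : U (st i.+1).2 (z - (st i.+1).1) -> ~ N i z.
  by have [_ _ _] := fP (i, st i) (stX i); exact.
have le_stm i : (i <= (st i).2)%N.
  by elim: i => // i IH; exact: leq_ltn_trans IH (stm i).
have stUD i k : U (st i).2 ((st (i + k)%N).1 - (st i).1).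
  elim: k => [|k IH]; first by rewrite addn0 subrr; exact: filt0.
  rewrite addnS -(subrKA (st (i + k)%N).1); apply: filtD IH.
  apply: (filt_le filtration) (stU (i + k)%N).
  elim: k => [|k]; first by rewrite addn0.
  by move=> /leq_trans; apply; rewrite addnS ltnW.
have stUle i j : (i <= j)%N -> U (st i).2 ((st j).1 - (st i).1).
  by move=> ij; rewrite -(subnKC ij).
have [||l Xl lP] := filt_complete filtration (u := fun i => (st i).1) => //.
  move=> k; exists k => i j ki kj.
  apply: (filt_le filtration) (le_stm k) _ _.
  rewrite -(subrKA (st k).1) -[X in _ + X]opprB.
  by apply: (filtB filtration); exact: stUle.
have [i _ Nl] := XN _ Xl.
apply: stN (Nl); have [j jP] := lP (st i.+1).2.
have {jP}jl := jP _ (leq_maxl j i.+1).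
rewrite -(subrKA (st (maxn j i.+1)).1) addrC -[X in _ + X]opprB.
apply: (filtB filtration) => //.
exact: stUle (leq_maxr _ _).
Qed.

(** The ball in which [S] is dense meets [S], and since the [U n] are
    subgroups this ball can be recentered at a point of [S]. *)
Lemma nonmeagre_somewhere_dense (S : set E) : ~ meagre S ->
  exists2 x, S x & exists n, forall u m, U n u ->
    exists2 d, S d & U m (d - (x + u)).
Proof.
move=> nS; have : ~ nowhere_dense S.
  by apply: contra_not nS; exists (fun=> S) => // x Sx; exists 0%N.
move=> /existsNP[x0 /existsNP[n]] /not_implyP[Xx0] /forallNP Sx0.
have dense y m : U n (y - x0) -> exists2 d, S d & U m (d - y).
  move=> yx; have /forallNP/(_ m)/not_andP[//|] := Sx0 y.
  by move=> /existsNP[z /not_implyP[zy /contrapT Sz]]; exists z.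
have [|x Sx xx0] := dense x0 n; first by rewrite subrr; exact: filt0.
exists x => //; exists n => u m Uu; apply: dense.
by rewrite addrAC; exact: filtD.
Qed.

End Baire.

(** * Topological modules over the generalized numbers *)

Section Topology.
Variable M : topologicalZmodType.
Implicit Types (x : M) (W : set M).

Lemma cvg_subr (u v : nat -> M) (a b : M) :
  u @ \oo --> a -> v @ \oo --> b -> (fun n => u n - v n) @ \oo --> a - b.
Proof.
move=> ua vb; apply: (@cvg_comp _ _ _ (fun n => (u n, v n))
  (fun z : M * M => z.1 - z.2)); last exact: (@sub_continuous M (a, b)).
exact: cvg_pair.
Qed.

Lemma nbhs_subr x W : nbhs 0 W -> nbhs x [set y | W (y - x)].
Proof.
move=> W0; have := @sub_continuous M (x, x); rewrite /continuous_at/= subrr.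
move=> /(_ _ W0)[[A B]/= [xA xB] AB]; apply: filterS xA => y Ay.
by apply: (AB (y, x)); split => //=; exact: nbhs_singleton.
Qed.

Lemma nbhs_addr x W : nbhs x W -> nbhs 0 [set h | W (x + h)].
Proof.
move=> Wx; have := @add_continuous M (x, 0); rewrite /continuous_at/= addr0.
move=> /(_ _ Wx)[[A B]/= [xA xB] AB]; apply: filterS xB => h Bh.
by apply: (AB (x, h)); split => //=; exact: nbhs_singleton.
Qed.

End Topology.

Section Scaling.
Variables (R : realType) (G : topologicalGModType R).
Implicit Types (A B V W : set G) (a b : R) (x y : G).

Lemma escaleP b A x : escale b A x <-> A (epow (- b) *: x).
Proof.
split=> [[y Ay <-]|Ax]; first by rewrite scalerA epowK scale1r.
by exists (epow (- b) *: x) => //; rewrite scalerA mulrC epowK scale1r.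
Qed.

Lemma escaleZ a b A x : escale (a + b) A (epow a *: x) <-> escale b A x.
Proof. by rewrite !escaleP scalerA -epowD opprD addrAC addNr add0r. Qed.

Lemma escale_le a b A : gconvex A -> a <= b -> escale b A `<=` escale a A.
Proof.
move=> [_ cA] ab x /escaleP Ax; apply/escaleP; apply: (cA (b - a)).
  by rewrite subr_ge0.
by exists (epow (- b) *: x) => //; rewrite scalerA -epowD addrAC subrr add0r.
Qed.

Lemma disk0 A : disk A -> A 0.
Proof.
move=> [[x Ax] bA _]; apply: (bA 0); first by rewrite abs_e0.
by exists x => //; rewrite scale0r.
Qed.

(** A convex set is stable by addition, without rescaling, so that an absolutely
    convex set is a subgroup as soon as it is nonempty. *)
Lemma gabsconvexB A x y : gabsolutely_convex A -> A x -> A y -> A (x - y).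
Proof.
move=> [bA [DA _]] Ax Ay; apply: DA; exists x => //; exists (- y) => //.
by apply: (bA (-1) (abs_eN1_le R)); exists y => //; rewrite scaleN1r.
Qed.

(** Neighborhoods of 0 are absorbing. *)
Lemma scale_cvg0 x W : nbhs 0 W ->
  exists p, forall b, p <= b -> W (epow b *: x).
Proof.
move=> W0; have := @Defs.scaler_continuous R G (0, x).
rewrite /continuous_at/= scale0r => /(_ _ W0)[[A B]/= [A0 Bx] AB].
have [r /= r0 rA] := (nbhs_ballP _ _).1 A0.
have [p pP] := abs_epow_lt r0; exists p => b pb.
apply: (AB (epow b, x)); split => /=; last exact: nbhs_singleton.
by apply: rA; rewrite ballEmdist /= /mdist/= sub0r abs_eN pP.
Qed.

Lemma nbhs0Z b W : nbhs 0 W -> nbhs 0 [set x : G | W (epow b *: x)].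
Proof.
move=> W0; have := @Defs.scaler_continuous R G (epow b, 0).
rewrite /continuous_at/= scaler0 => /(_ _ W0)[[A B]/= [Ab B0] AB].
apply: filterS B0 => x Bx; apply: (AB (epow b, x)); split => //=.
exact: nbhs_singleton.
Qed.

(** The largest balanced subset of a convex neighborhood [W'] of 0 is still
    convex.  It is a neighborhood of 0 because the scaling is continuous at
    (0, 0): for some neighborhood [B] of 0 and some [p], the multiples of
    [epow p *: B] by scalars of norm at most 1 are all in [W']. *)
Lemma locally_gabsconvex : glocally_convex G -> forall W, nbhs 0 W ->
  exists V, [/\ nbhs 0 V, gabsolutely_convex V & V `<=` W].
Proof.
move=> lG W /lG[W' [W'0 [DW' eW'] W'W]].
exists [set x | forall l : gcomplex R, abs_e l <= 1 -> W' (l *: x)]; split.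
- have := @Defs.scaler_continuous R G (0, 0); rewrite /continuous_at/= scale0r.
  move=> /(_ _ W'0)[[A B]/= [A0 B0] AB].
  have [r /= r0 rA] := (nbhs_ballP _ _).1 A0.
  have [p pP] := abs_epow_lt r0.
  apply: filterS (nbhs0Z (- p) B0) => x Bx l l1.
  have -> : l *: x = (l * epow p) *: (epow (- p) *: x).
    by rewrite scalerA -mulrA [epow p * _]mulrC epowK mulr1.
  apply: (AB (l * epow p, epow (- p) *: x)); split => //=; apply: rA.
  rewrite ballEmdist /= /mdist/= sub0r abs_eN.
  by apply: le_lt_trans (pP p (lexx _)); exact: abs_eM_le.
- split; [|split].
  + move=> l l1 _ [x Wx <-] m m1; rewrite scalerA; apply: Wx; exact: abs_eM_le.
  + move=> _ [x Wx [y Wy <-]] l l1; rewrite scalerDr; apply: DW'.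
    by exists (l *: x); [exact: Wx|exists (l *: y); [exact: Wy|]].
  + move=> b b0 _ [x Wx <-] l l1; rewrite scalerA mulrC -scalerA.
    by apply: (eW' b b0); exists (l *: x) => //; exact: Wx.
- move=> x Wx; apply: W'W; rewrite -[x]scale1r; apply: Wx.
  by rewrite -abs_eN abs_eN1_le.
Qed.

End Scaling.

(** * Banach disks *)

Section Disks.
Variables (R : realType) (G : topologicalGModType R) (B : set G).

Lemma disk_norm_le (b : R) u :
  escale b B u -> (disk_norm B u <= (expR (- b))%:E)%E.
Proof.
move=> Bu; rewrite -[(expR _)%:E]/(expeR (- b)%:E) lee_expeR EFinN leeN2.
by apply: ereal_sup_ubound; exists b.
Qed.

Lemma disk_norm_lt (b : R) u : gconvex B ->
  (disk_norm B u < (expR (- b))%:E)%E -> escale b B u.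
Proof.
move=> cB; rewrite -[(expR _)%:E]/(expeR (- b)%:E) lte_expeR EFinN lteN2.
move=> /ereal_sup_gt[_ [c Bc <-]]; rewrite lte_fin => /ltW bc.
exact: escale_le bc _ Bc.
Qed.

(** By [disk_norm_le] and [disk_norm_lt], the set [escale n B] lies between the
    open and the closed ball of radius [expR (- n)] for the norm of [B]. *)
Lemma Banach_disk_filtration : Banach_disk B ->
  complete_filtration (disk_span B) (fun n => escale n%:R B).
Proof.
move=> [dB _ cB]; have [_ bB cvB] := dB.
have aB : gabsolutely_convex B by [].
split.
- exists 0%N => //; apply/escaleP; rewrite scaler0; exact: disk0.
- move=> n x u [k _ Bx] Bu; exists k => //; apply/escaleP; rewrite scalerDr.
  apply: cvB.1; exists (epow (- - k%:R) *: x); first exact/escaleP.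
  exists (epow (- - k%:R) *: u) => //; apply/escaleP.
  by apply: escale_le Bu => //; rewrite (@le_trans _ _ 0)// oppr_le0.
- by move=> n; apply/escaleP; rewrite scaler0; exact: disk0.
- move=> n u v /escaleP Bu /escaleP Bv; apply/escaleP; rewrite scalerBr.
  exact: gabsconvexB.
- by move=> m n mn; apply: escale_le => //; rewrite ler_nat.
- move=> u uX u_cauchy; have [|l lX ul] := cB u uX.
    move=> e e0; have [N NP] := u_cauchy (Num.truncn `|1 - ln e|).+1.
    exists N => i j Ni Nj; apply: le_lt_trans (disk_norm_le (NP _ _ Ni Nj)) _.
    rewrite lte_fin -[e in ltRHS]lnK// ltr_expR.
    have := truncnS_gt `|1 - ln e|; have := ler_norm (1 - ln e).
    by lra.
  exists l => // k; have [N NP] := ul _ (expR_gt0 (- k%:R)).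
  by exists N => i /NP; exact: disk_norm_lt.
Qed.

(** The inclusion of the span of [B] in [G] is continuous. *)
Lemma gbounded_filtration (W : set G) : gbounded B -> nbhs 0 W ->
  exists n, escale n%:R B `<=` W.
Proof.
move=> bB /bB[a aP]; exists (Num.truncn `|a|).+1 => x /escaleP Bx.
have {}Bx := aP _ _ _ Bx; apply: contrapT => nWx; apply: nWx.
have /Bx/escaleP : - (Num.truncn `|a|).+1%:R <= a.
  have := truncnS_gt `|a|; have := ler_norm (- a); rewrite normrN.
  by lra.
by rewrite scalerA epowK scale1r.
Qed.

End Disks.

(** * Webs *)

Section Webs.
Variables (R : realType) (F : topologicalGModType R).
Variables (E : zmodType) (X : set E) (U : nat -> set E).

(** Meagre sets form a sigma-ideal, so one of the countably many pieces into
    which the web splits a nonmeagre set is again nonmeagre. *)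
Lemma web_nonmeagre_branch (C : seq nat -> set F) (f : E -> F) :
  is_web C -> ~ meagre X U X ->
  exists2 n : nat -> nat, forall k, (0 < n k)%N &
    forall k, (0 < k)%N ->
      ~ meagre X U (f @^-1` C [seq n i | i <- iota 1 k]).
Proof.
move=> [C1 Cs] nX.
(* [C] has no meaning at the empty sequence: the whole space replaces it. *)
pose good s := all (ltn 0) s /\
  ~ meagre X U (if s is [::] then setT else f @^-1` C s).
have extend s : good s -> exists i, good (rcons s i).
  move=> [s0 ns]; apply: contrapT => /forallNP bad; apply: ns.
  pose S i := f @^-1` C (rcons s i.+1).
  apply: (@meagre_sub _ _ _ _ (\bigcup_i S i)).
  - have cover x : (exists2 i, (0 < i)%N & C (rcons s i) (f x)) ->
        (\bigcup_i S i) x.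
      by move=> [[//|i] _ Cx]; exists i.
    case: s s0 @S cover {bad} => [_|a s s0] S cover x.
    + by move=> _; apply: cover; have : [set: F] (f x) by []; rewrite C1.
    + by rewrite /preimage/= Cs// => -[i i0 Cx]; apply: cover; exists i.
  - apply: meagre_bigcup => i.
    have := bad i.+1; rewrite /good all_rcons/= s0 => /not_andP[//|].
    by move/contrapT; rewrite /S; case: (s).
have good0 : good [::].
  by split => // sT; apply: nX; apply: meagre_sub sT.
have /choice[nx nxP] : forall s, exists i, good s -> good (rcons s i).
  move=> s; have [gs|] := pselect (good s); last by exists 0%N.
  by have [j] := extend s gs; exists j.
pose br := fix br k := if k is j.+1 then rcons (br j) (nx (br j)) else [::].
pose n k := nx (br k.-1).
have brE k : br k = [seq n i | i <- iota 1 k].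
  elim: k => // k IH.
  have -> : iota 1 k.+1 = rcons (iota 1 k) k.+1.
    by rewrite -[in LHS](addn1 k) iotaD cats1.
  by rewrite map_rcons -IH.
have good_br k : good (br k) by elim: k => //= k /nxP.
exists n.
  by move=> k; have [] := good_br k.-1.+1; rewrite /= all_rcons => /andP[].
move=> [//|k] _; have [_] := good_br k.+1; rewrite -brE /=.
by case: (br k).
Qed.

End Webs.

(** * The closed graph theorem *)

Section ClosedGraph.
Variables (R : realType) (G F : topologicalGModType R) (T : {linear G -> F}).

(** As [V] is absorbing, the preimages of its multiples [epow (- i) *: V], with
    [i] a natural number, cover [S]. *)
Lemma nonmeagre_bounded_part (X : set G) (U : nat -> set G) (S : set G)
    (V : set F) : nbhs 0 V -> ~ meagre X U S ->
  exists p : R, ~ meagre X U (S `&` [set x | V (epow p *: T x)]).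
Proof.
move=> V0 nS; apply: contrapT => /forallNP mS; apply: nS.
apply: (@meagre_sub _ _ _ _
  (\bigcup_i (S `&` [set x | V (epow (i : nat)%:R *: T x)]))).
  move=> x Sx; have [p pV] := scale_cvg0 (T x) V0.
  exists (Num.truncn `|p|).+1 => //; split => //; apply: pV.
  by rewrite (le_trans (ler_norm _))// ltW// truncnS_gt.
by apply: meagre_bigcup => i; apply: contrapT; exact: mS.
Qed.

(** The closed graph theorem for the restriction of [T] to the span of [B],
    which is complete for the norm of [B]. *)
Lemma closed_graph_Banach_disk (B : set G) (V : set F) :
  has_web_type_C F -> sequentially_closed (graph T) ->
  Banach_disk B -> gbounded B -> gabsolutely_convex V -> nbhs 0 V ->
  exists n, escale n%:R B `<=` T @^-1` V.
Proof.
move=> [C webC typeC] closedT BB bB aV V0.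
have fil := Banach_disk_filtration BB; have [dB _ _] := BB.
have [_ _ cB] := dB; have [_ cV] := aV.
pose U n := escale n%:R B.
have [n n0 nonmeagreC] := web_nonmeagre_branch T webC (Baire_nonmeagre fil).
have [rho rhoP] := typeC n (fun k _ => n0 k).
pose D k p := (T @^-1` C [seq n i | i <- iota 1 k]) `&`
  [set x | V (epow p *: T x)].
have /choice[q qP] : forall k, exists q : R * (G * nat), (0 < k)%N ->
    D k q.1 q.2.1 /\ forall u m, U q.2.2 u ->
      exists2 d, D k q.1 d & U m (d - (q.2.1 + u)).
  case=> [|k]; first by exists (0, (0, 0%N)).
  have [p nD] := nonmeagre_bounded_part V0 (nonmeagreC k.+1 isT).
  have [x Dx [N Nx]] := nonmeagre_somewhere_dense fil nD.
  by exists (p, (x, N)) => _; split.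
pose p k := (q k).1; pose x k := (q k).2.1; pose N k := (q k).2.2.
pose lam k := Num.max (Num.max (rho k) (p k)) 0.
(* [rho k] ensures the convergence of the series, and [p k] that the images of
   its terms lie in [V]; nonnegative exponents shrink the sets [U m]. *)
have rho_lam k : rho k <= lam k by rewrite !le_max lexx.
have p_lam k : p k <= lam k by rewrite !le_max lexx orbT.
have lam0 k : 0 <= lam k by rewrite le_max lexx orbT.
have V_lam k z : D k (p k) z -> V (epow (lam k) *: T z).
  move=> [_ Vz]; rewrite -[lam k]opprK; apply/escaleP.
  by apply: (@escale_le _ _ _ (- p k)); rewrite ?lerN2//;
    apply/escaleP; rewrite opprK.
pose s k := (N k + (Num.truncn (lam k)).+1 + k)%N.
(* A remainder in [U (s k)], divided by [epow (lam k)], lies in [U (N k)], and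
   [D k (p k)] is dense in the translate of [U (N k)] by [x k].  The summand [k]
   makes the sets [U (s k)] shrink to 0. *)
have s_lam k : (N k)%:R <= (s k)%:R - lam k.
  by rewrite /s !natrD; have := truncnS_gt (lam k); have := ler0n R k; lra.
(* Density turns a remainder at scale [s k] into one at scale [s k.+1]. *)
have /choice[nxt nxtP] : forall kr : nat * G, exists d, (0 < kr.1)%N ->
    U (s kr.1) kr.2 -> D kr.1 (p kr.1) d /\
      U (s kr.1.+1) (kr.2 - epow (lam kr.1) *: (d - x kr.1)).
  move=> [[|k] r] /=; first by exists 0.
  have [Ur|] := pselect (U (s k.+1) r); last by exists 0.
  have UNr : U (N k.+1) (epow (- lam k.+1) *: r).
    apply: (escale_le cB (s_lam k.+1)); apply/escaleP.
    by rewrite scalerA -epowD opprB addrAC subrr add0r; apply/escaleP.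
  have [d Dd Ud] := (qP k.+1 isT).2 _ (s k.+2) UNr.
  exists d => _ _; split => //.
  have -> : r - epow (lam k.+1) *: (d - x k.+1) =
      - (epow (lam k.+1) *: (d - (x k.+1 + epow (- lam k.+1) *: r))).
    rewrite opprD addrA [in RHS]scalerBr scalerA mulrC epowK scale1r.
    by rewrite opprB.
  rewrite -[X in U _ X]sub0r; apply: (filtB fil); first exact: (filt0 fil).
  apply: (@escale_le _ _ (s k.+2)%:R (lam k.+1 + (s k.+2)%:R)) => //.
    by rewrite lerDr.
  exact/escaleZ.
exists (s 1%N) => x0 Ux0.
(* [r m] is the remainder after [m] steps; it lies at scale [s m.+1] because the
   terms of the series are numbered from 1. *)
pose r := fix r m := if m is j.+1
  then r j - epow (lam j.+1) *: (nxt (j.+1, r j) - x j.+1) else x0.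
pose d k := nxt (k, r k.-1).
have rU m : U (s m.+1) (r m).
  by elim: m => // m IH; have [_] := nxtP (m.+1, r m) isT IH.
have Dd k : (0 < k)%N -> D k (p k) (d k).
  by case: k => // k _; have [] := nxtP (k.+1, r k) isT (rU k).
pose P m := \sum_(1 <= k < m.+1) epow (lam k) *: (d k - x k).
have PE m : P m = x0 - r m.
  rewrite /P; elim: m => [|m IH]; first by rewrite big_geq// subrr.
  by rewrite big_nat_recr//= IH opprB addrA addrAC.
have P_cvg : P @ \oo --> x0.
  move=> W /nbhs_addr /(gbounded_filtration bB)[k kW].
  exists k => // m /= km; rewrite PE; apply: (kW (- r m)).
  rewrite -sub0r; apply: (filtB fil); first exact: (filt0 fil).
  apply: (filt_le fil) (rU m) => //; rewrite (leq_trans km)//.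
  by rewrite (leq_trans (leqnSn _))// leq_addl.
have TPE m : T (P m) = \sum_(1 <= k < m.+1) epow (lam k) *: T (d k) -
    \sum_(1 <= k < m.+1) epow (lam k) *: T (x k).
  rewrite linear_sum -sumrB; apply: eq_bigr => k _.
  by rewrite linearZ_LR linearB scalerBr.
have [|l1 l1P] := rhoP lam (T \o d).
  by move=> k k0; split => //; have [] := Dd k k0.
have [|l2 l2P] := rhoP lam (T \o x).
  by move=> k k0; split => //; have [[]] := qP k k0.
have TP_cvg : (fun m => T (P m)) @ \oo --> l1 - l2.
  by under eq_fun do rewrite TPE; exact: cvg_subr l1P l2P.
have Tx0 : graph T (x0, l1 - l2).
  apply: (closedT (fun m => (P m, T (P m))) (fun=> erefl)).
  exact: (cvg_pair P_cvg TP_cvg).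
rewrite /graph/= in Tx0.
have dV : V 0 := nbhs_singleton V0.
have VTP m : V (T (P m)).
  rewrite TPE; apply: gabsconvexB => //; rewrite big_nat_cond;
    apply: (big_ind V) => // [y z Vy Vz|k].
  - by apply: cV.1; exists y => //; exists z.
  - by rewrite andbT => /andP[k0 _]; apply: V_lam; exact: Dd.
  - by apply: cV.1; exists y => //; exists z.
  - by rewrite andbT => /andP[k0 _]; apply: V_lam; have [] := qP k k0.
(* A subgroup that is a neighborhood of 0 is closed. *)
have [m _ /(_ m (leqnn m))/= Vm] := TP_cvg _ (nbhs_subr _ V0).
rewrite /preimage/= -Tx0 -[l1 - l2](subKr (T (P m))).
exact: gabsconvexB.
Qed.

End ClosedGraph.

Theorem proposition1p10 (R : realType) (G F : topologicalGModType R)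
  (hG : hausdorff_space G) (uG : ultrabornological G)
  (lF : glocally_convex F) (wF : has_web_type_C F)
  (T : {linear G -> F}) (hT : sequentially_closed (graph T)) :
  continuous T.
Proof.
have [_ ultra] := uG.
have T0 W : nbhs 0 W -> nbhs 0 (T @^-1` W).
  move=> /(locally_gabsconvex lF)[V [V0 aV VW]].
  apply: (@filterS _ _ _ (T @^-1` V)); first by move=> x; exact: VW.
  have [bV [DV eV]] := aV.
  apply: ultra => [|B BB bB].
    split; [|split].
    - move=> l l1 _ [x Vx <-]; rewrite /preimage/= linearZ_LR.
      by apply: (bV l l1); exists (T x).
    - move=> _ [x Vx [y Vy <-]]; rewrite /preimage/= linearD.
      by apply: DV; exists (T x) => //; exists (T y).
    - move=> b b0 _ [x Vx <-]; rewrite /preimage/= linearZ_LR.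
      by apply: (eV b b0); exists (T x).
  have [n nV] := closed_graph_Banach_disk wF hT BB bB aV V0.
  have [[_ _ cB] _ _] := BB.
  exists (- n%:R) => b bn x Bx; apply/escaleP; apply: nV.
  apply: (@escale_le _ _ _ (- b)) => //; first by rewrite lerNr.
  by apply/escaleP; rewrite opprK scalerA -epowD subrr epow0 scale1r.
move=> x W /nbhs_addr/T0/(nbhs_subr x); apply: filterS => y.
by rewrite /preimage/= linearB addrCA subrr addr0.
Qed.
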